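(* Let $p$ be a prime and let $f:\mathbb{Z}_p\times\mathbb{Z}_p\to\mathbb{Z}_p$ be additively inseparable with $\Delta(f)>2$. Let $P$ be a no-signalling box with inputs and outputs in $\mathbb{Z}_p$ that satisfies information causality. For $x,y,j\in\mathbb{Z}_p$ let $$E_{x,y,j}=\sum_{k=0}^{p-1}P(a=k,\,b=k-f(x,y)+j\mid x,y),$$ and let $\nu_j=\min_{x,y\in\mathbb{Z}_p}E_{x,y,j}$. Then: (i) for every integer $1\le N\le p$, with $L=(N-1)2^{\Delta(f)-2}$, and every $c\in\mathbb{Z}_p$, $$\frac1p\sum_{k=0}^{p-1}\omega_p^{ck}\Big(\sum_{j=0}^{p-1}\nu_j\omega_p^{jk}\Big)^{L/2}\Big(\sum_{j=0}^{p-1}\nu_j\omega_p^{-jk}\Big)^{L/2}\le T_p^{-1}\Big(\frac{N-1}{N}\log_2p\Big);$$ (ii) for every $n\ge1$, with $N=p^n$ and $L=n(p-1)2^{\Delta(f)-2}$, and every $c\in\mathbb{Z}_p$, the same inequality holds. Here $\omega_p=e^{2\pi i/p}$.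
   Context: Let $p$ be a prime. All arithmetic on elements of $\mathbb{Z}_p$ is modulo $p$. A box is a conditional probability distribution $P(a,b\mid x,y)$ with $a,b,x,y\in\mathbb{Z}_p$. It is shared by Alice, who supplies $x$ and receives $a$, and Bob, who supplies $y$ and receives $b$. Different copies act independently. $P$ is no-signalling if $\sum_bP(a,b\mid x,y)$ does not depend on $y$ and $\sum_aP(a,b\mid x,y)$ does not depend on $x$. A function $f$ is additively separable if $f(x,y)=g(x)+h(y)$ for some $g,h:\mathbb{Z}_p\to\mathbb{Z}_p$. Otherwise it is additively inseparable. Every $f$ can be written uniquely as $f(x,y)=\sum_{i,j=0}^{p-1}\lambda_{i,j}x^iy^j$. Define $\Delta(f)=\max_{1\le i,j\le p-1}\mathbb{I}_{\lambda_{i,j}\ne0}(i+j)$, the maximal total degree of a monomial with nonzero coefficient divisible by $xy$. $P$ satisfies information causality if, for every $N\ge1$, every protocol of the following form satisfies $\sum_{i=0}^{N-1}I(x_i:b\mid y=i)\le\log_2p$. In the protocol: - Alice receives $\vec x=(x_0,\dots,x_{N-1})$ uniform in $\mathbb{Z}_p^N$, and Bob receives $y$ uniform in $\{0,\dots,N-1\}$, independent of $\vec x$. - They share randomness (independent of the inputs) and finitely many copies of $P$. - Alice's inputs to her ends of the boxes are functions of $\vec x$, the shared randomness, and her previously obtained outputs. - Alice sends a single message $q\in\mathbb{Z}_p$ to Bob, which is a function of $\vec x$, the randomness, and her outputs. - Bob's inputs to his ends of the boxes are functions of $y$, $q$, the shared randomness, and his previously obtained outputs. - Bob finally outputs $b\in\mathbb{Z}_p$.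 Here $I(x_i:b\mid y=i)$ is the Shannon mutual information (in bits) between $x_i$ and $b$ under the distribution conditioned on $y=i$. Let $h(x)=-x\log_2x-(1-x)\log_2(1-x)$ and $T_p(x)=h(x)+(1-x)\log_2(p-1)$. On $[1/p,1]$, $T_p$ decreases strictly from $\log_2p$ to $0$. $T_p^{-1}:[0,\log_2p]\to[1/p,1]$ denotes the inverse of this restriction. *)

(* Defs.v *)
From HB Require Import structures.
From mathcomp Require Import all_boot all_algebra.
From Stdlib Require Import Reals ClassicalEpsilon.

Set Implicit Arguments.
Unset Strict Implicit.
Unset Printing Implicit Defensive.

Definition rsum (T : finType) (F : T -> R) : R := \big[Rplus/0%R]_(i : T) F i.
Definition rprod (T : finType) (F : T -> R) : R := \big[Rmult/1%R]_(i : T) F i.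

Definition log2 (x : R) : R := (ln x / ln 2)%R.

(* ---------- boxes: P a b x y = P(a,b | x,y), all in Z_p = 'F_p ---------- *)
Definition box (p : nat) := 'F_p -> 'F_p -> 'F_p -> 'F_p -> R.

Definition is_box (p : nat) (P : box p) : Prop :=
  (forall a b x y, (0 <= P a b x y)%R) /\
  (forall x y, rsum (fun ab : 'F_p * 'F_p => P ab.1 ab.2 x y) = 1%R).

Definition no_signalling (p : nat) (P : box p) : Prop :=
  (forall a x y y', rsum (fun b => P a b x y) = rsum (fun b => P a b x y')) /\
  (forall b x x' y, rsum (fun a => P a b x y) = rsum (fun a => P a b x' y)).

(* terms with J u v = 0 vanish because they are multiplied by 0 *)
Definition mutual_info (p : nat) (J : 'F_p -> 'F_p -> R) : R :=
  rsum (fun uv : 'F_p * 'F_p =>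
    (J uv.1 uv.2 *
     log2 (J uv.1 uv.2 / (rsum (fun v => J uv.1 v) * rsum (fun u => J u uv.2))))%R).

(* A party's strategy [next] maps its history (list of (box used, output
   obtained)) to the next box to use and the input to feed it.  Given the
   vector [a] of outputs of all m boxes, [run] lists the steps
   (box, input, output). *)
Fixpoint run (p m : nat) (fuel : nat)
    (next : seq ('I_m * 'F_p) -> 'I_m * 'F_p) (a : 'I_m -> 'F_p)
    (h : seq ('I_m * 'F_p)) : seq ('I_m * 'F_p * 'F_p) :=
  match fuel with
  | 0 => [::]
  | S f => let kx := next h in
           (kx.1, kx.2, a kx.1) :: run f next a (rcons h (kx.1, a kx.1))
  end.

Definition history_of (p m : nat) (s : seq ('I_m * 'F_p * 'F_p)) : seq ('I_m * 'F_p) :=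
  map (fun st => (st.1.1, st.2)) s.

(* input fed to box k (first use); boxes never used get input 0, which is
   harmless by no-signalling *)
Definition input_of (p m : nat) (s : seq ('I_m * 'F_p * 'F_p)) (k : 'I_m) : 'F_p :=
  match [seq st <- s | st.1.1 == k] with
  | st :: _ => st.1.2
  | [::] => GRing.zero
  end.

(* Joint distribution of (x_i, b) conditioned on y = i, for the protocol with
   shared randomness (Lam, mu), m copies of P, Alice's strategy nextA and
   message msg, Bob's strategy nextB and final guess. *)
Definition ic_joint (p N : nat) (P : box p) (Lam : finType) (mu : Lam -> R) (m : nat)
    (nextA : {ffun 'I_N -> 'F_p} -> Lam -> seq ('I_m * 'F_p) -> 'I_m * 'F_p)
    (msg : {ffun 'I_N -> 'F_p} -> Lam -> seq ('I_m * 'F_p) -> 'F_p)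
    (nextB : 'I_N -> 'F_p -> Lam -> seq ('I_m * 'F_p) -> 'I_m * 'F_p)
    (guess : 'I_N -> 'F_p -> Lam -> seq ('I_m * 'F_p) -> 'F_p)
    (i : 'I_N) (u v : 'F_p) : R :=
  rsum (fun xv : {ffun 'I_N -> 'F_p} =>
   if xv i == u then
    rsum (fun l : Lam =>
     rsum (fun a : {ffun 'I_m -> 'F_p} =>
      rsum (fun b : {ffun 'I_m -> 'F_p} =>
        let sA := run m (nextA xv l) a [::] in
        let q := msg xv l (history_of sA) in
        let sB := run m (nextB i q l) b [::] in
        if guess i q l (history_of sB) == v then
          (/ INR (expn p N) * mu l *
           rprod (fun k : 'I_m => P (a k) (b k) (input_of sA k) (input_of sB k)))%R
        else 0%R)))
   else 0%R).

Definition info_causality (p : nat) (P : box p) : Prop :=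
  forall (N : nat), (0 < N)%N ->
  forall (Lam : finType) (mu : Lam -> R),
    (forall l, (0 <= mu l)%R) -> rsum mu = 1%R ->
  forall (m : nat)
    (nextA : {ffun 'I_N -> 'F_p} -> Lam -> seq ('I_m * 'F_p) -> 'I_m * 'F_p)
    (msg : {ffun 'I_N -> 'F_p} -> Lam -> seq ('I_m * 'F_p) -> 'F_p)
    (nextB : 'I_N -> 'F_p -> Lam -> seq ('I_m * 'F_p) -> 'I_m * 'F_p)
    (guess : 'I_N -> 'F_p -> Lam -> seq ('I_m * 'F_p) -> 'F_p),
  (rsum (fun i : 'I_N =>
     mutual_info (ic_joint P mu nextA msg nextB guess i)) <= log2 (INR p))%R.

Definition additively_separable (p : nat) (f : 'F_p -> 'F_p -> 'F_p) : Prop :=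
  exists (g h : 'F_p -> 'F_p), forall x y, f x y = GRing.add (g x) (h y).

Definition represents (p : nat) (lam : 'I_p -> 'I_p -> 'F_p) (f : 'F_p -> 'F_p -> 'F_p) : Prop :=
  forall x y : 'F_p,
    f x y = \big[GRing.add/GRing.zero]_(ij : 'I_p * 'I_p)
              GRing.mul (GRing.mul (lam ij.1 ij.2) (GRing.exp x ij.1)) (GRing.exp y ij.2).

Definition DeltaOf (p : nat) (lam : 'I_p -> 'I_p -> 'F_p) : nat :=
  \max_(ij : 'I_p * 'I_p | (0 < ij.1)%N && (0 < ij.2)%N && (lam ij.1 ij.2 != GRing.zero))
     (ij.1 + ij.2)%N.

Definition Eterm (p : nat) (P : box p) (f : 'F_p -> 'F_p -> 'F_p) (x y j : 'F_p) : R :=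
  rsum (fun k : 'F_p => P k (GRing.add (GRing.add k (GRing.opp (f x y))) j) x y).

Definition nu (p : nat) (P : box p) (f : 'F_p -> 'F_p -> 'F_p) (j : 'F_p) : R :=
  \big[Rmin/Eterm P f GRing.zero GRing.zero j]_(xy : 'F_p * 'F_p) Eterm P f xy.1 xy.2 j.

Definition hbin (x : R) : R := (- x * log2 x - (1 - x) * log2 (1 - x))%R.
Definition Tp (p : nat) (x : R) : R := (hbin x + (1 - x) * log2 (INR p - 1))%R.
Definition Tp_inv (p : nat) (t : R) : R :=
  epsilon (inhabits 0%R) (fun x => (/ INR p <= x <= 1)%R /\ Tp p x = t).

Definition C := (R * R)%type.
Definition Cadd (z w : C) : C := ((z.1 + w.1)%R, (z.2 + w.2)%R).
Definition Cmul (z w : C) : C :=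
  ((z.1 * w.1 - z.2 * w.2)%R, (z.1 * w.2 + z.2 * w.1)%R).
Definition Cscale (r : R) (z : C) : C := ((r * z.1)%R, (r * z.2)%R).
Definition Cpow (z : C) (n : nat) : C := iter n (Cmul z) (1%R, 0%R).
Definition Csum (T : finType) (F : T -> C) : C :=
  (rsum (fun i => (F i).1), rsum (fun i => (F i).2)).
Definition omega_pow (p : nat) (e : R) : C :=
  (cos (2 * PI * e / INR p), sin (2 * PI * e / INR p)).

Definition ic_lhs (p : nat) (nuv : 'F_p -> R) (c : 'F_p) (L : nat) : C :=
  Cscale (/ INR p)
   (Csum (fun k : 'F_p =>
     Cmul (omega_pow p (INR c * INR k))
      (Cmul
        (Cpow (Csum (fun j : 'F_p => Cscale (nuv j) (omega_pow p (INR j * INR k)))) (L./2))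
        (Cpow (Csum (fun j : 'F_p => Cscale (nuv j) (omega_pow p (- (INR j * INR k))))) (L./2))))).

(* Main.v *)
(** Let i + j = Delta(f) be the largest total degree of a mixed monomial x^i y^j
    of f.  Taking i - 1 finite differences in x and j - 1 in y turns f into
    C x y + g(x) + h(y) with C <> 0, i.e. a signed sum of 2^(Delta(f)-2) shifted
    copies of f, half of them with each sign.  So that many boxes multiply an
    input of Alice by an input of Bob up to local terms and a signed sum of box
    errors.  Since x_y = x_0 + sum_t (x_t - x_0) [y = t], M - 1 products give a
    random access code on M values, and nesting it n times one on M^n values in
    which only the n nodes on the path to Bob's index contribute errors.

    Whatever happened before, the error of a box equals j with probability at
    least nu_j, so the signed error sum is - c with probability at least the L-fold
    convolution of the nu_j and nu_{-j}, and this is the left-hand side of the claim by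
    Fourier inversion on Z_p.  If it exceeded x = T_p^{-1}((N-1)/N log p), then
    Gibbs' inequality with reference success probability x would give each of
    the N mutual informations a value above (log p) / N, contradicting
    information causality.  Part (i) is n = 1, M = N; part (ii) is M = p. *)
Require Import Defs.
From Stdlib Require Import Reals Psatz ClassicalEpsilon.
From HB Require Import structures.
From mathcomp Require Import all_boot all_order all_algebra.
From mathcomp Require Import Rstruct.

Set Implicit Arguments.
Unset Strict Implicit.
Unset Printing Implicit Defensive.

Import GRing.Theory Num.Theory Order.TTheory.

(** * The function T_p and Fano's inequality *)

Section EntropyFunction.
Local Open Scope R_scope.

Lemma prime_INR_ge2 p : prime p -> 2 <= INR p.
Proof. by move=> pp; rewrite -[2]/(INR 2); apply: le_INR; apply/ssrnat.leP/prime_gt1. Qed.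

Lemma ln2_gt0 : 0 < ln 2.
Proof. by rewrite -ln_1; apply: ln_increasing; lra. Qed.

Lemma ln_ge_1_sub_inv y : 0 < y -> 1 - / y <= ln y.
Proof.
move=> y0; have := exp_ineq1_le (- ln y).
by rewrite exp_Ropp exp_ln //; lra.
Qed.

Lemma log2_mul x y : 0 < x -> 0 < y -> log2 (x * y) = log2 x + log2 y.
Proof. by move=> x0 y0; rewrite /log2 ln_mult // /Rdiv; ring. Qed.

Lemma log2_inv x : 0 < x -> log2 (/ x) = - log2 x.
Proof. by move=> x0; rewrite /log2 ln_Rinv // /Rdiv; ring. Qed.

Lemma log2_lt x y : 0 < x -> x < y -> log2 x < log2 y.
Proof.
move=> x0 xy; apply: Rmult_lt_compat_r; last exact: ln_increasing.
exact/Rinv_0_lt_compat/ln2_gt0.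
Qed.

Variables (p : nat).
Hypothesis p2 : 2 <= INR p.

Lemma ln_pred_ge0 : 0 <= ln (INR p - 1).
Proof.
case: (Req_dec (INR p - 1) 1) => [-> | ne]; first by rewrite ln_1; lra.
by rewrite -ln_1; apply/Rlt_le/ln_increasing; lra.
Qed.

Lemma Tp_continuous x : 0 < x < 1 -> continuity_pt (Tp p) x.
Proof.
move=> [x0 x1].
have cln y : 0 < y -> continuity_pt ln y.
  move=> y0; apply: derivable_continuous_pt.
  by exists (/ y); exact: derivable_pt_lim_ln.
have cid : continuity_pt id x by apply: derivable_continuous_pt; exact: derivable_pt_id.
have cst (c : R) : continuity_pt (fun _ => c) x by exact: continuity_pt_const.
have c1 : continuity_pt (fun y => 1 - y) x by apply: continuity_pt_minus.
have clog : continuity_pt log2 x by apply: continuity_pt_mult => //; exact: cln.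
have clog1 : continuity_pt (fun y => log2 (1 - y)) x.
  apply: (continuity_pt_comp (fun y => 1 - y) log2) => //.
  by apply: continuity_pt_mult; [apply: cln; lra | exact: continuity_pt_const].
apply: continuity_pt_plus.
  apply: continuity_pt_minus; apply: continuity_pt_mult => //.
  exact: continuity_pt_opp.
exact: continuity_pt_mult.
Qed.

Lemma Tp_at_inv : Tp p (/ INR p) = log2 (INR p).
Proof.
rewrite /Tp /hbin.
rewrite (_ : 1 - / INR p = (INR p - 1) * / INR p); last by field; lra.
have ip : 0 < / INR p by apply: Rinv_0_lt_compat; lra.
rewrite log2_mul ?log2_inv; try lra.
by field; lra.
Qed.

Lemma Tp_at_1 : Tp p 1 = 0.
Proof. by rewrite /Tp /hbin /log2 ln_1 /Rdiv; ring. Qed.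

(* The only point where T_p is not visibly continuous is 1, where a square root
   bounds the entropy. *)
Lemma Tp_near_1 w : 0 < w <= 1 / 2 ->
  Tp p (1 - w * w) <= w * (2 + ln (INR p - 1)) / ln 2.
Proof.
move=> [w0 w1]; have l2 := ln2_gt0.
have K0 := ln_pred_ge0.
set K := ln _ in K0 *.
have -> : Tp p (1 - w * w) =
  (- ((1 - w * w) * ln (1 - w * w)) - 2 * (w * (w * ln w)) + w * w * K) / ln 2.
  rewrite /Tp /hbin /log2 (_ : 1 - (1 - w * w) = w * w); last by ring.
  by rewrite (ln_mult w w) // -/K; field; lra.
apply: Rmult_le_compat_r; first exact/Rlt_le/Rinv_0_lt_compat.
have ww : 0 < 1 - w * w by nra.
have h1 := ln_ge_1_sub_inv ww; have h2 := ln_ge_1_sub_inv w0.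
have e1 : - ((1 - w * w) * ln (1 - w * w)) <= w * w.
  have := Rmult_le_compat_l _ _ _ (Rlt_le _ _ ww) h1.
  by rewrite Rmult_minus_distr_l Rinv_r; lra.
have e2 : - (w * ln w) <= 1 - w.
  have := Rmult_le_compat_l _ _ _ (Rlt_le _ _ w0) h2.
  by rewrite Rmult_minus_distr_l Rinv_r; lra.
have e3 : - (w * (w * ln w)) <= w * (1 - w) by nra.
have wK : 0 <= w * K by nra.
have e4 : w * w * K <= w * K by nra.
nra.
Qed.

(** The intermediate value theorem between 1/p, where T_p = log p > t, and a point 1 - w^2, where
    T_p < t, yields a preimage for [epsilon]. The value t = 0 is attained at 1. *)
Lemma Tp_inv_spec t : 0 <= t < log2 (INR p) ->
  / INR p <= Tp_inv p t <= 1 /\ Tp p (Tp_inv p t) = t.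
Proof.
move=> [t0 t1].
suff : exists x, / INR p <= x <= 1 /\ Tp p x = t by exact: epsilon_spec.
have ip : 0 < / INR p <= / 2.
  by split; [apply: Rinv_0_lt_compat; lra | apply: Rinv_le_contravar; lra].
case: t0 => [t0|<-]; last by exists 1; rewrite Tp_at_1; split=> //; lra.
have l2 := ln2_gt0.
have K0 := ln_pred_ge0.
set K := ln _ in K0.
(* With this w the bound of [Tp_near_1] is at most t/2; the cap 1/2 also keeps 1 - w^2 above 1/p. *)
pose w := Rmin (1 / 2) (t * ln 2 / (2 * (2 + K))).
have tl : 0 < t * ln 2 by nra.
have w0 : 0 < w.
  apply: Rmin_glb_lt; first lra.
  by apply: Rmult_lt_0_compat => //; apply: Rinv_0_lt_compat; lra.
have w1 : w <= 1 / 2 by exact: Rmin_l.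
have wt : Tp p (1 - w * w) < t.
  apply: Rle_lt_trans (Tp_near_1 (conj w0 w1)) _.
  have h : w <= t * ln 2 / (2 * (2 + K)) by exact: Rmin_r.
  apply: (Rmult_lt_reg_r (ln 2)) => //.
  rewrite /Rdiv Rmult_assoc Rinv_l ?Rmult_1_r -/K; last lra.
  have -> : t * ln 2 = 2 * (t * ln 2 / (2 * (2 + K)) * (2 + K)) by field; lra.
  nra.
have [||||z [zb z0]] := @Ranalysis5.IVT_interv (fun z => t - Tp p z) (/ INR p) (1 - w * w).
- move=> a ab; apply: continuity_pt_minus; first exact: continuity_pt_const.
  by apply: Tp_continuous; nra.
- nra.
- by rewrite Tp_at_inv; lra.
- by lra.
by exists z; split; [nra | lra].
Qed.

End EntropyFunction.

(** * Gibbs' inequality and the bound on the success probability *)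

Section MutualInformation.
Local Open Scope R_scope.

Lemma rsum_le (T : finType) (F G : T -> R) :
  (forall i, F i <= G i) -> rsum F <= rsum G.
Proof.
by move=> h; apply: (big_ind2 Rle) => // *; [exact: Rle_refl | exact: Rplus_le_compat].
Qed.

Lemma rsum_ge_term (T : finType) (F : T -> R) i : (forall i, 0 <= F i) -> F i <= rsum F.
Proof.
move=> F0; rewrite /rsum (bigD1 i) //= -[X in X <= _]Rplus_0_r; apply: Rplus_le_compat_l.
by apply: (big_ind (fun z => 0 <= z)) => //; [lra | move=> *; lra].
Qed.

Lemma rsum_ext (T : finType) (F G : T -> R) : (forall i, F i = G i) -> rsum F = rsum G.
Proof. by move=> h; apply: eq_bigr => i _. Qed.

Lemma rsum_add (T : finType) (F G : T -> R) :
  rsum (fun i => F i + G i) = rsum F + rsum G.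
Proof. exact: (@big_split _ _ (+%R : R -> R -> R)). Qed.

Lemma rsum_mull (T : finType) c (F : T -> R) :
  rsum (fun i => c * F i) = c * rsum F.
Proof. by rewrite /rsum -(@mulr_sumr R). Qed.

Lemma rsum_const (T : finType) c : rsum (fun _ : T => c) = INR #|T| * c.
Proof. by rewrite /rsum (@sumr_const R) INRE RmultE mulr_natl. Qed.

Lemma rsum_if (T : finType) (v : T) c : rsum (fun u => if u == v then c else 0) = c.
Proof. by rewrite /rsum -big_mkcond big_pred1_eq. Qed.

Lemma rsum_pair (S T : finType) (F : S -> T -> R) :
  rsum (fun st : S * T => F st.1 st.2) = rsum (fun s => rsum (F s)).
Proof. by rewrite /rsum -(@pair_bigA R). Qed.

Lemma rsum_exchange (S T : finType) (F : S -> T -> R) :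
  rsum (fun s => rsum (F s)) = rsum (fun t => rsum (fun s => F s t)).
Proof. exact: (@exchange_big R). Qed.

(** Factor J/(Ju Jv) as (r/Ju) (J/(Jv r)) and apply ln z >= 1 - 1/z to the second factor. The linear
    correction J - Jv r sums to 0 once r is a conditional distribution of u given v. *)
Lemma gibbs_term J Ju Jv r : 0 < Ju -> 0 <= J <= Jv -> 0 < r ->
  J * log2 (r * / Ju) + / ln 2 * (J + -1 * (Jv * r)) <= J * log2 (J / (Ju * Jv)).
Proof.
move=> Ju0 [[J0|<-] JJv] r0; have il := Rinv_0_lt_compat _ ln2_gt0; last first.
  have Jr : 0 <= Jv * r by nra.
  by rewrite !Rmult_0_l; nra.
have Jv0 : 0 < Jv by lra.
have q0 : 0 < J / (Jv * r) by apply: Rdiv_lt_0_compat => //; nra.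
have -> : J / (Ju * Jv) = (r * / Ju) * (J / (Jv * r)) by field; lra.
have rJ : 0 < r * / Ju by apply: Rmult_lt_0_compat => //; exact: Rinv_0_lt_compat.
rewrite (log2_mul rJ q0).
have := ln_ge_1_sub_inv q0.
rewrite (_ : / (J / (Jv * r)) = Jv * r / J); last by field; lra.
move=> h; rewrite [J * (_ + _)]Rmult_plus_distr_l; apply: Rplus_le_compat_l.
rewrite /log2 (_ : J * (_ / _) = / ln 2 * (J * ln (J / (Jv * r)))); last by rewrite /Rdiv; ring.
apply: Rmult_le_compat_l; first lra.
have := Rmult_le_compat_l _ _ _ (Rlt_le _ _ J0) h.
by rewrite (_ : J * (1 - _) = J + -1 * (Jv * r)) //; field; lra.
Qed.

(* Fano's inequality, with the true success probability inside the logarithms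
   replaced by an arbitrary reference value x. *)
Lemma mutual_info_ge (p : nat) (J : 'F_p -> 'F_p -> R) x : prime p -> 0 < x < 1 ->
  (forall u v, 0 <= J u v) -> (forall u, rsum (J u) = / INR p) ->
  let s := rsum (fun u => J u u) in
  log2 (INR p) + s * log2 x + (1 - s) * log2 ((1 - x) / (INR p - 1)) <= mutual_info J.
Proof.
move=> pp [x0 x1] J0 Ju s.
have p2 := prime_INR_ge2 pp.
have ip : 0 < / INR p by apply: Rinv_0_lt_compat; lra.
pose y := (1 - x) / (INR p - 1).
have y0 : 0 < y by apply: Rdiv_lt_0_compat; lra.
(* Reference distribution of u given v: right with probability x, otherwise uniform on the p - 1
   wrong values. *)
pose r (u v : 'F_p) := if u == v then x else y.
have r0 u v : 0 < r u v by rewrite /r; case: ifP.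
have tot : rsum (fun u => rsum (J u)) = 1.
  by rewrite (rsum_ext Ju) rsum_const card_Fp // Rinv_r //; lra.
have rE v : rsum (fun u => r u v) = 1.
  rewrite /rsum (eq_bigr (fun u => y + if u == v then x - y else 0)); last first.
    by move=> u _; rewrite /r; case: eqP => _; lra.
  rewrite -/(rsum _) rsum_add rsum_const rsum_if card_Fp // /y; field; lra.
rewrite /mutual_info.
apply: (@Rle_trans _ (rsum (fun uv : 'F_p * 'F_p =>
    J uv.1 uv.2 * log2 (r uv.1 uv.2 * / / INR p) +
    / ln 2 * (J uv.1 uv.2 + -1 * (rsum (fun u => J u uv.2) * r uv.1 uv.2)))));
  last first.
  apply: rsum_le => -[u v] /=; rewrite Ju.
  apply: (gibbs_term ip _ (r0 u v)); split; first exact: J0.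
  exact: (rsum_ge_term (F := fun u => J u v)).
rewrite rsum_add !rsum_mull rsum_add rsum_mull.
rewrite (rsum_pair (fun u v => J u v)) tot.
rewrite (rsum_pair (fun u v => rsum (fun u => J u v) * r u v)) rsum_exchange.
rewrite (rsum_ext (G := fun v => rsum (fun u => J u v))); last first.
  by move=> v; rewrite rsum_mull rE Rmult_1_r.
rewrite -rsum_exchange tot (_ : 1 + -1 * 1 = 0); last ring.
rewrite Rmult_0_r Rplus_0_r.
rewrite (rsum_pair (fun u v => J u v * log2 (r u v * / / INR p))).
rewrite Rinv_inv.
have lE u v : J u v * log2 (r u v * INR p) =
   (log2 y + log2 (INR p)) * J u v + (if v == u then (log2 x - log2 y) * J u u else 0).
  rewrite log2_mul //; last lra.
  by rewrite /r eq_sym; case: eqP => [->|_]; ring.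
rewrite (_ : rsum _ = (log2 y + log2 (INR p)) * 1 + (log2 x - log2 y) * s).
  by rewrite /y; lra.
rewrite -{1}tot -!rsum_mull -rsum_add; apply: eq_bigr => u _.
rewrite -[X in _ + X](rsum_if u) -rsum_mull -rsum_add.
by apply: eq_bigr => v _; rewrite lE.
Qed.

(** The Fano bound at reference x increases with the success probability and equals log p - T_p(x) =
    (log p)/N at success x. If S > x, each of the N terms exceeds (log p)/N. *)
Lemma success_le_Tp_inv (p N : nat) (J : 'I_N -> 'F_p -> 'F_p -> R) S :
  prime p -> (0 < N)%N ->
  (forall i u v, 0 <= J i u v) -> (forall i u, rsum (J i u) = / INR p) ->
  (forall i, S <= rsum (fun u => J i u u)) ->
  rsum (fun i => mutual_info (J i)) <= log2 (INR p) ->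
  S <= Tp_inv p ((INR N - 1) / INR N * log2 (INR p)).
Proof.
move=> pp N0 J0 Ju JS IC.
have p2 := prime_INR_ge2 pp.
have N1 : 1 <= INR N by rewrite -[1]/(INR 1); apply: le_INR; apply/ssrnat.leP.
have lp : 0 < log2 (INR p).
  by rewrite (_ : 0 = log2 1); [apply: log2_lt; lra | rewrite /log2 ln_1 /Rdiv; ring].
set t := _ * log2 _.
have tE : INR N * t = (INR N - 1) * log2 (INR p) by rewrite /t; field; lra.
have tb : 0 <= t < log2 (INR p).
  split; last by apply: (Rmult_lt_reg_l (INR N)); lra.
  by apply: (Rmult_le_reg_l (INR N)); [lra | rewrite tE; nra].
have [[x0 x1] xE] := Tp_inv_spec p2 tb.
set x := Tp_inv p t in x0 x1 xE *.
apply: Rnot_lt_le => xS.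
have S1 : S <= 1.
  apply: Rle_trans (JS (Ordinal N0)) _.
  rewrite -(_ : rsum (fun u => rsum (J (Ordinal N0) u)) = 1); last first.
    by rewrite (rsum_ext (Ju (Ordinal N0))) rsum_const card_Fp // Rinv_r //; lra.
  by apply: rsum_le => u; exact: rsum_ge_term.
have ip : 0 < / INR p by apply: Rinv_0_lt_compat; lra.
have x0' : / INR p < x.
  case: x0 => // e; have := Tp_at_inv p2; rewrite e xE; lra.
have xlt1 : x < 1 by lra.
pose y := (1 - x) / (INR p - 1).
have y0 : 0 < y by apply: Rdiv_lt_0_compat; lra.
(* A single wrong value is less likely than the right one because x > 1/p; this makes the Fano bound
   increase in s. *)
have yx : y < x.
  have px : 1 < x * INR p.
    by have := Rmult_lt_compat_r (INR p) _ _ _ x0'; rewrite Rinv_l; lra.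
  apply: (Rmult_lt_reg_r (INR p - 1)); first lra.
  by rewrite /y /Rdiv Rmult_assoc Rinv_l; lra.
have lyx := log2_lt y0 yx.
have TE : Tp p x = - x * log2 x - (1 - x) * log2 y.
  rewrite /Tp /hbin /y /Rdiv log2_mul; try lra.
    rewrite log2_inv; [ring | lra].
  by apply: Rinv_0_lt_compat; lra.
suff : INR N * (log2 (INR p) - t) < rsum (fun i => mutual_info (J i)) by lra.
rewrite -xE TE.
(* The gain in each Fano bound from success S instead of x. *)
pose d := (S - x) * (log2 x - log2 y).
have d0 : 0 < d by rewrite /d; nra.
suff : INR N * (log2 (INR p) - Tp p x + d) <= rsum (fun i => mutual_info (J i)) by rewrite TE; nra.
rewrite -[N in INR N]card_ord -rsum_const; apply: rsum_le => i.
apply: Rle_trans (mutual_info_ge pp (conj _ xlt1) (J0 i) (Ju i)); last lra.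
by rewrite -/y TE /d; have := JS i; nra.
Qed.

End MutualInformation.

(** * Powers of the root of unity as pairs of reals *)

Section RootsOfUnity.
Local Open Scope R_scope.
Variables (p : nat).
Hypothesis p2 : 2 <= INR p.

Lemma omega_powD a b : omega_pow p (a + b) = Cmul (omega_pow p a) (omega_pow p b).
Proof.
rewrite /omega_pow /Cmul /= (_ : 2 * PI * (a + b) / INR p =
  2 * PI * a / INR p + 2 * PI * b / INR p); last by field; lra.
by rewrite cos_plus sin_plus; congr (_, _); ring.
Qed.

Lemma omega_pow_0 : omega_pow p 0 = (1, 0).
Proof. by rewrite /omega_pow Rmult_0_r /Rdiv Rmult_0_l cos_0 sin_0. Qed.

Lemma omega_pow_p : omega_pow p (INR p) = (1, 0).
Proof.
rewrite /omega_pow (_ : 2 * PI * INR p / INR p = 2 * PI); last by field; lra.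
by rewrite cos_2PI sin_2PI.
Qed.

Lemma omega_pow_1_lt : (omega_pow p 1).1 < 1.
Proof.
rewrite /= -[X in _ < X]cos_0; have P0 := PI_RGT_0.
have ip : 0 < / INR p by apply: Rinv_0_lt_compat; lra.
have x0 : 0 < 2 * PI * 1 / INR p by apply: Rmult_lt_0_compat => //; lra.
have x1 : 2 * PI * 1 / INR p <= PI.
  apply: (Rmult_le_reg_r (INR p)); first lra.
  by rewrite /Rdiv Rmult_assoc Rinv_l; nra.
by apply: cos_decreasing_1; lra.
Qed.

End RootsOfUnity.

From mathcomp Require Import complex ring zify.

(** * Finite differences *)

Section FiniteDifferences.
Local Open Scope ring_scope.
Variables (p : nat) (pp : prime p).
Local Notation F := 'F_p.
Implicit Types (f : F -> F -> F) (lam : 'I_p -> 'I_p -> F).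

Definition xdiff f (x y : F) : F := f (x + 1) y - f x y.
Definition xdiff_coef lam (l b : 'I_p) : F :=
  \sum_(a < p | (l < a)%N) lam a b *+ 'C(a, l).

Lemma expr_diff (x : F) (a : 'I_p) :
  (x + 1) ^+ a - x ^+ a = \sum_(l < p | (l < a)%N) x ^+ l *+ 'C(a, l).
Proof.
rewrite exprD1n big_ord_recr /= binn mulr1n addrK.
rewrite (big_ord_widen p (fun i => x ^+ i *+ 'C(a, i))) //.
exact/ltnW/ltn_ord.
Qed.

Lemma represents_xdiff lam f :
  represents lam f -> represents (xdiff_coef lam) (xdiff f).
Proof.
move=> Hf x y; rewrite /xdiff !Hf -sumrB.
under eq_bigr => ij _ do
  rewrite -mulrBl -mulrBr expr_diff.
rewrite -(pair_bigA _ (fun a b : 'I_p => lam a b *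
  (\sum_(l < p | (l < a)%N) x ^+ l *+ 'C(a, l)) * y ^+ b)) /=.
rewrite -(pair_bigA _ (fun a b : 'I_p => xdiff_coef lam a b * x ^+ a * y ^+ b)) /=.
rewrite exchange_big [RHS]exchange_big; apply: eq_bigr => b _.
rewrite -!mulr_suml; congr (_ * _).
under eq_bigr => a _ do rewrite mulr_sumr.
rewrite (exchange_big_dep predT) //=; apply: eq_bigr => l _.
rewrite mulr_suml; apply: eq_bigr => a _.
by rewrite mulrnAr mulrnAl.
Qed.

Definition leading_mixed lam (i j : 'I_p) :=
  lam i j != 0 /\
  forall a b : 'I_p, (0 < a)%N -> (0 < b)%N -> lam a b != 0 -> (a + b <= i + j)%N.

(** In the new coefficient at (i - 1, j) only the term a = i survives, as a > i would exceed the top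
    mixed degree. It equals i times the old coefficient, nonzero because 0 < i < p. *)
Lemma leading_mixed_xdiff lam (i i' j : 'I_p) :
  (0 < j)%N -> i = i'.+1 :> nat -> leading_mixed lam i j ->
  leading_mixed (xdiff_coef lam) i' j.
Proof.
move=> j0 ei [nz top]; split.
  rewrite /xdiff_coef (bigD1 i) ?ei //= big1 => [|a /andP[la ne]].
    rewrite addr0 binSn -mulr_natr mulf_neq0 //.
    by rewrite -(dvdn_pcharf (pchar_Fp pp)) gtnNdvd // -ei.
  suff /eqP -> : lam a j == 0 by rewrite mul0rn.
  apply/negPn/negP=> /(top a j) h.
  have a0 : (0 < a)%N by apply: leq_ltn_trans la.
  have ne' : a != i :> nat by [].
  have := h a0 j0; lia.
move=> a b a0 b0 nzab; rewrite leqNgt; apply/negP=> lt.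
move/negP: nzab; apply; apply/eqP; rewrite /xdiff_coef big1 // => c la.
suff /eqP -> : lam c b == 0 by rewrite mul0rn.
by apply/negPn/negP=> /(top c b) h; have := h _ b0; lia.
Qed.

Definition shift_sum (sq : seq (bool * F * F)) f (x y : F) : F :=
  \sum_(d <- sq) (-1) ^+ d.1.1 * f (x + d.1.2) (y + d.2).

Definition bilinear_up_to_local (u : F -> F -> F) :=
  exists (C : F) (g h : F -> F), C != 0 /\
    forall x y, u x y = C * x * y + g x + h y.

(** For n > 0 both signs occur equally often; the two roundings also cover n = 0, a single term with
    positive sign. *)
Definition good_shifts n f := exists sq : seq (bool * F * F),
  [/\ count (fun d => ~~ d.1.1) sq = uphalf (2 ^ n),
      count (fun d => d.1.1) sq = (2 ^ n)./2 &
      bilinear_up_to_local (shift_sum sq f)].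

Lemma good_shifts_tr n f : good_shifts n (fun x y => f y x) -> good_shifts n f.
Proof.
move=> [sq [c1 c2 [C [g [h [nz E]]]]]].
exists [seq (d.1.1, d.2, d.1.2) | d <- sq]; split; rewrite ?count_map //.
exists C, h, g; split=> // x y.
by rewrite /shift_sum big_map /= addrAC mulrAC -E.
Qed.

(** Each term splits into one at x + 1 with the same sign and one at x with the opposite sign, so
    the list doubles and the signs balance. *)
Lemma good_shifts_xdiff n f : good_shifts n (xdiff f) -> good_shifts n.+1 f.
Proof.
move=> [sq [c1 c2 [C [g [h [nz E]]]]]].
have szE : (count (fun d => ~~ d.1.1) sq + count (fun d => d.1.1) sq = 2 ^ n)%N.
  by rewrite c1 c2 uphalf_half -addnA addnn odd_double_half.
exists ([seq (d.1.1, d.1.2 + 1, d.2) | d <- sq] ++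
        [seq (~~ d.1.1, d.1.2, d.2) | d <- sq]); split.
- rewrite count_cat !count_map /= expnS mul2n uphalf_double -szE; congr (_ + _)%N.
  by apply: eq_count => d /=; rewrite negbK.
- rewrite count_cat !count_map /= expnS mul2n doubleK -szE.
  exact: addnC.
exists C, g, h; split=> // x y; rewrite -E /shift_sum big_cat !big_map /=.
rewrite -big_split; apply: eq_bigr => d _ /=.
rewrite /xdiff addrA; case: d.1.1 => /=; rewrite ?expr0 ?expr1; ring.
Qed.

(** Induction on the leading degree: each difference lowers one exponent by 1, until xy is the only
    mixed monomial left. *)
Lemma good_shifts_leading n lam f (i j : 'I_p) :
  represents lam f -> leading_mixed lam i j -> (0 < i)%N -> (0 < j)%N ->
  (i + j = n.+2)%N -> good_shifts n f.
Proof.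
elim: n lam f i j => [|n IH] lam f i j Hf lead i0 j0 eij.
  have [ei ej] : i = 1%N :> nat /\ j = 1%N :> nat by lia.
  case: lead => nz top.
  exists [:: (false, 0, 0)]; split=> //.
  exists (lam i j).
  (* The constant monomial is counted in g, hence excluded from h. *)
  exists (fun x => \sum_(ij : 'I_p * 'I_p | ij.2 == 0%N :> nat) lam ij.1 ij.2 * x ^+ ij.1).
  exists (fun y => \sum_(ij : 'I_p * 'I_p | (ij.2 != 0%N :> nat) && (ij.1 == 0%N :> nat))
                     lam ij.1 ij.2 * y ^+ ij.2).
  split=> // x y; rewrite /shift_sum big_seq1 /= expr0 mul1r !addr0 Hf.
  rewrite (bigID (fun ij : 'I_p * 'I_p => ij.2 == 0%N :> nat)) /=.
  rewrite [X in _ + X](bigID (fun ij : 'I_p * 'I_p => ij.1 == 0%N :> nat)) /=.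
  rewrite [LHS]addrA [LHS]addrC [LHS]addrA.
  congr (_ + _); first congr (_ + _).
  + rewrite (bigD1 (i, j)) /=; last by rewrite ei ej.
    rewrite ei ej !expr1 big1 ?addr0 // => -[a b] /= /andP[/andP[b0 a0] ne].
    have [->|/top h] := eqVneq (lam a b) 0; first by rewrite !mul0r.
    case/negP: ne; apply/eqP; congr (_, _); apply: ord_inj;
    move: (h); rewrite !lt0n => /(_ a0 b0); lia.
  + by apply: eq_bigr => ij /eqP ->; rewrite expr0 mulr1.
  + by apply: eq_bigr => ij /andP[_ /eqP ->]; rewrite expr0 mulr1.
(* If i = 1 then j > 1, and the two variables can be exchanged. *)
wlog i2 : lam f i j Hf lead i0 j0 eij / (1 < i)%N.
  move=> wl; have [i2|i1] := ltnP 1 i; first exact: (wl lam f i j).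
  apply: good_shifts_tr; apply: (wl (fun a b => lam b a) _ j i) => //; try lia.
  - move=> x y; rewrite Hf.
    rewrite -(pair_bigA _ (fun a b : 'I_p => lam a b * y ^+ a * x ^+ b)) /=.
    rewrite -(pair_bigA _ (fun a b : 'I_p => lam b a * x ^+ a * y ^+ b)) /=.
    rewrite exchange_big; apply: eq_bigr => a _; apply: eq_bigr => b _.
    exact: mulrAC.
  - case: lead => nz top; split=> // a b a0 b0 /top h.
    by rewrite addnC [X in (_ <= X)%N]addnC; exact: h.
have lt : (i.-1 < p)%N by have := ltn_ord i; lia.
apply: good_shifts_xdiff.
apply: (IH (xdiff_coef lam) _ (Ordinal lt) j); rewrite //=; try lia.
- exact: represents_xdiff.
- by apply: leading_mixed_xdiff lead => //=; lia.
Qed.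

Lemma good_shifts_Delta lam f :
  represents lam f -> (2 < DeltaOf lam)%N -> good_shifts (DeltaOf lam - 2) f.
Proof.
move=> Hf HD.
have [|[i j] /= /andP[/andP[i0 j0] nz] e] := @eq_bigmax_cond _
  (fun ij : 'I_p * 'I_p => (0 < ij.1)%N && (0 < ij.2)%N && (lam ij.1 ij.2 != 0))
  (fun ij => ij.1 + ij.2)%N.
  (* Without mixed monomials the maximum would be the default 0, against Delta > 2. *)
  rewrite lt0n; apply/negP=> /eqP /eqP/pred0P h.
  by move: HD; rewrite /DeltaOf big_pred0.
have eD : DeltaOf lam = (i + j)%N by exact: e.
apply: (@good_shifts_leading _ lam f i j) => //; last by lia.
split=> // a b a0 b0 nzab; rewrite -eD /DeltaOf.
by apply: (bigop.bigmax_sup (a, b)); rewrite /= ?leqnn // a0 b0.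
Qed.

End FiniteDifferences.

(** * Fourier inversion *)

Section Characters.
Local Open Scope ring_scope.

Definition complex_of (z : Defs.C) : R[i] := Complex z.1 z.2.

Lemma complex_of_mul z w : complex_of (Cmul z w) = complex_of z * complex_of w.
Proof. by []. Qed.

Lemma complex_of_scale r z : complex_of (Cscale r z) = (r%:C)%C * complex_of z.
Proof. by apply/eqP; rewrite eq_complex /= !mul0r subr0 addr0 !eqxx. Qed.

Lemma complex_of_pow z n : complex_of (Cpow z n) = complex_of z ^+ n.
Proof. by elim: n => // n IH; rewrite exprS -IH. Qed.

Lemma complex_of_sum (T : finType) (G : T -> Defs.C) :
  complex_of (Csum G) = \sum_i complex_of (G i).
Proof.
rewrite /Csum /rsum /complex_of /=.
by elim/big_rec3: _ => // i x a b _ <-.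
Qed.

Variables (p : nat) (pp : prime p).
Local Notation F := 'F_p.

Definition omega : R[i] := complex_of (omega_pow p 1).

Let p2 : Rle 2 (INR p).
Proof. exact: prime_INR_ge2. Qed.

Lemma complex_of_omega_pow n : complex_of (omega_pow p (INR n)) = omega ^+ n.
Proof.
elim: n => [|n IH]; first by rewrite /= omega_pow_0.
by rewrite S_INR omega_powD // complex_of_mul IH exprSr.
Qed.

Lemma omega_p : omega ^+ p = 1.
Proof. by rewrite -complex_of_omega_pow omega_pow_p. Qed.

Lemma omega_neq1 : omega != 1.
Proof.
by apply/negP=> /eqP [h _]; have := omega_pow_1_lt p2; rewrite /= h; apply: Rlt_irrefl.
Qed.

Definition chi (z : F) : R[i] := omega ^+ z.

Lemma chi_nat n : chi n%:R = omega ^+ n.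
Proof. by rewrite /chi val_Fp_nat // (expr_mod _ omega_p). Qed.

Lemma chiD z w : chi (z + w) = chi z * chi w.
Proof. by rewrite -{1}[z]natr_Zp -{1}[w]natr_Zp -natrD chi_nat exprD. Qed.

Lemma chi0 : chi 0 = 1. Proof. exact: expr0. Qed.

Lemma complex_of_omega_pow_mul (z w : F) :
  complex_of (omega_pow p (Rmult (INR z) (INR w))) = chi (z * w).
Proof.
rewrite -mult_INR multE complex_of_omega_pow -chi_nat natrM.
by rewrite !natr_Zp.
Qed.

(** Both sides are inverses of [chi (z * w)]. *)
Lemma complex_of_omega_pow_opp (z w : F) :
  complex_of (omega_pow p (Ropp (Rmult (INR z) (INR w)))) = chi (- (z * w)).
Proof.
set a := Rmult _ _.
have h : chi (z * w) * complex_of (omega_pow p (Ropp a)) = 1.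
  by rewrite -complex_of_omega_pow_mul -complex_of_mul -omega_powD // Rplus_opp_r omega_pow_0.
have h' : chi (z * w) * chi (- (z * w)) = 1 by rewrite -chiD subrr chi0.
have nz : chi (z * w) != 0.
  by apply: contra_eq_neq h => ->; rewrite mul0r eq_sym oner_neq0.
by apply: (mulfI nz); rewrite h h'.
Qed.

(** For z <> 0, rescaling reduces to z = 1; translating k by 1 then multiplies the sum by [chi 1],
    which is not 1. *)
Lemma sum_chi (z : F) : \sum_(k : F) chi (z * k) = if z == 0 then p%:R else 0.
Proof.
case: eqVneq => [->|nz].
  rewrite (eq_bigr (fun _ => 1)) => [|k _]; last by rewrite mul0r chi0.
  by rewrite sumr_const card_Fp.
rewrite (reindex_inj (mulfI (invr_neq0 nz))) /=.
under eq_bigr => k _ do rewrite mulVKf //.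
apply/eqP; suff : (\sum_k chi k) * (chi 1 - 1) == 0.
  rewrite mulf_eq0 subr_eq0 => /orP[//|].
  by rewrite /chi -[1]/(1%:R) val_Fp_nat // modn_small ?prime_gt1 // expr1 (negPf omega_neq1).
rewrite mulrBr mulr1 subr_eq0 mulr_suml [X in _ == X](reindex_inj (addIr (1 : F))) /=.
by apply/eqP/eq_bigr => k _; rewrite chiD.
Qed.

Variables (nuv : F -> R).

Definition fourier (s k : F) : R[i] := \sum_j ((nuv j)%:C)%C * chi (s * j * k).

Definition fourier_factor (s k : F) : R[i] := if s == 0 then 1 else fourier s k.

(* Lower bound on the probability that z plus the sum of sigma_l e_l over
   k <= l < k + n vanishes, when each error e_l takes the value j with
   conditional probability at least nu_j; errors with sigma_l = 0 are free. *)
Fixpoint zero_sum_bound (sigma : nat -> F) (n k : nat) (z : F) : R :=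
  match n with
  | 0 => (z == 0)%:R
  | n'.+1 => if sigma k == 0 then zero_sum_bound sigma n' k.+1 z
             else \sum_j nuv j * zero_sum_bound sigma n' k.+1 (z + sigma k * j)
  end.

(** Each recursion step is a convolution, hence a product of transforms; the base case is the
    orthogonality of characters. *)
Lemma zero_sum_bound_fourier sigma n k z :
  ((zero_sum_bound sigma n k z)%:C)%C =
  p%:R^-1 * \sum_x chi (z * x) * \prod_(k <= l < k + n) fourier_factor (sigma l) x.
Proof.
elim: n k z => [|n IH] k z /=.
  rewrite addn0; under eq_bigr => x _ do rewrite big_geq // mulr1.
  rewrite sum_chi; case: eqP => _; last by rewrite mulr0.
  by rewrite mulVf // pnatr_eq0 -lt0n prime_gt0.
have split x : \prod_(k <= l < k + n.+1) fourier_factor (sigma l) x =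
    fourier_factor (sigma k) x * \prod_(k.+1 <= l < k.+1 + n) fourier_factor (sigma l) x.
  by rewrite big_ltn ?addnS ?addSn // ltnS leq_addr.
under [X in _ = _ * X]eq_bigr => x _ do rewrite split.
case: ifPn => sk.
  by rewrite IH; congr (_ * _); apply: eq_bigr => x _; rewrite {2}/fourier_factor sk mul1r.
rewrite rmorph_sum /=.
under eq_bigr => j _ do rewrite rmorphM /= IH mulrCA.
rewrite -mulr_sumr; congr (_ * _).
under [LHS]eq_bigr => j _ do rewrite mulr_sumr.
rewrite exchange_big; apply: eq_bigr => x _.
rewrite [fourier_factor (sigma k) x]/fourier_factor (negPf sk) /fourier.
rewrite mulr_suml mulr_sumr; apply: eq_bigr => j _.
by rewrite mulrDl chiD; ring.
Qed.

Lemma ic_lhs_fourier c L :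
  complex_of (ic_lhs nuv c L) =
  p%:R^-1 * \sum_x chi (c * x) * (fourier 1 x ^+ L./2 * fourier (-1) x ^+ L./2).
Proof.
rewrite /ic_lhs complex_of_scale complex_of_sum; congr (_ * _).
  by rewrite INRE RinvE fmorphV rmorph_nat.
apply: eq_bigr => x _.
rewrite !complex_of_mul !complex_of_pow !complex_of_sum complex_of_omega_pow_mul.
rewrite /fourier; congr (_ * (_ ^+ _ * _ ^+ _)); apply: eq_bigr => j _.
  by rewrite complex_of_scale complex_of_omega_pow_mul mul1r.
by rewrite complex_of_scale complex_of_omega_pow_opp mulN1r mulNr.
Qed.

(** Both have the same Fourier expansion, and the bound is real, so the imaginary part vanishes. *)
Lemma ic_lhs_zero_sum_bound sigma m c L :
  (forall x, \prod_(0 <= l < m) fourier_factor (sigma l) x =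
             fourier 1 x ^+ L./2 * fourier (-1) x ^+ L./2) ->
  ic_lhs nuv c L = (zero_sum_bound sigma m 0 c, 0).
Proof.
move=> h; have := ic_lhs_fourier c L.
under eq_bigr => x _ do rewrite -h.
rewrite -[in X in _ = X](add0n m) -zero_sum_bound_fourier.
by case: (ic_lhs _ _ _) => a b [-> ->].
Qed.

End Characters.

(** * Error distribution of sequentially used boxes *)

Lemma rsumE (T : finType) (G : T -> R) : rsum G = (\sum_i G i)%R.
Proof. by []. Qed.

Section OutcomeTrees.
Local Open Scope ring_scope.
Variables (T : finType) (w : seq T -> T -> R).

(** For conditional probabilities [w], this is the expectation of [Phi] after n more outcomes, given
    the history h. *)
Fixpoint tree_sum (n : nat) (Phi : seq T -> R) (h : seq T) : R :=
  if n is n'.+1 then \sum_c w h c * tree_sum n' Phi (rcons h c) else Phi h.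

Lemma big_tuple_cons n (G : n.+1.-tuple T -> R) :
  \sum_t G t = \sum_(c : T) \sum_(t : n.-tuple T) G [tuple of c :: t].
Proof.
rewrite pair_bigA /=.
rewrite (reindex (fun ct : T * n.-tuple T => [tuple of ct.1 :: ct.2])) //=.
exists (fun t => (thead t, [tuple of behead t])) => [[c t] _ | t _] /=.
  by congr (_, _); apply: val_inj.
by case/tupleP: t => c t; apply: val_inj.
Qed.

Lemma tree_sumE n Phi h x0 :
  tree_sum n Phi h =
  \sum_(t : n.-tuple T) (\prod_(k < n) w (h ++ take k t) (nth x0 t k)) * Phi (h ++ t).
Proof.
elim: n h => [|n IH] h /=.
  rewrite (big_pred1 [tuple]) => [|t]; last by apply/esym/eqP; exact: tuple0.
  by rewrite big_ord0 mul1r cats0.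
rewrite big_tuple_cons; apply: eq_bigr => c _; rewrite IH mulr_sumr.
apply: eq_bigr => t _; rewrite big_ord_recl /= cats0 mulrA cat_rcons.
by congr (_ * _ * _); apply: eq_bigr => k _; rewrite cat_rcons.
Qed.

Lemma tree_sum_total n h : (forall h, \sum_c w h c = 1) -> tree_sum n (fun _ => 1) h = 1.
Proof.
move=> w1; elim: n h => //= n IH h.
by under eq_bigr => c _ do rewrite IH mulr1.
Qed.

Lemma eq_tree_sum n Phi Phi' h :
  (forall t, size t = n -> Phi (h ++ t) = Phi' (h ++ t)) ->
  tree_sum n Phi h = tree_sum n Phi' h.
Proof.
elim: n h => [|n IH] h e /=; first by have := e [::] erefl; rewrite cats0.
apply: eq_bigr => c _; congr (_ * _); apply: IH => t st.
by rewrite cat_rcons e //= st.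
Qed.

End OutcomeTrees.

(** * Conditional probabilities of box errors *)

Section BoxErrors.
Local Open Scope ring_scope.
Variables (p : nat) (pp : prime p) (P : box p) (f : 'F_p -> 'F_p -> 'F_p).
Hypothesis HP : is_box P.
Local Notation F := 'F_p.

Let P0 a b x y : 0 <= P a b x y. Proof. by apply/RleP; case: HP. Qed.

Lemma Eterm_ge0 x y j : 0 <= Eterm P f x y j.
Proof. exact: sumr_ge0. Qed.

Lemma nu_le x y j : nu P f j <= Eterm P f x y j.
Proof.
rewrite /nu; have := mem_index_enum (x, y).
elim: (index_enum _) => // xy s IH; rewrite inE big_cons RminE.
by case/orP => [/eqP <-|/IH h]; rewrite ge_min ?lexx // h orbT.
Qed.

Lemma nu_ge0 j : 0 <= nu P f j.
Proof.
rewrite /nu; apply: (big_ind (fun z => 0 <= z)) => [|x y x0 y0|xy _]; rewrite ?Eterm_ge0 //.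
by rewrite RminE le_min x0.
Qed.

Lemma zero_sum_bound_ge0 sigma n k z : 0 <= zero_sum_bound (nu P f) sigma n k z.
Proof.
elim: n k z => [|n IH] k z /=; first by case: (_ == _).
case: ifP => // _; apply: sumr_ge0 => j _; apply: mulr_ge0 => //; exact: nu_ge0.
Qed.

Variables (X : nat -> (nat -> F) -> F) (Y sigma : nat -> F) (z0 : F).

Definition xin (h : seq (F * F)) : F := X (size h) (nth 0 (unzip1 h)).

Definition outcome_weight (h : seq (F * F)) (c : F * F) : R :=
  P c.1 c.2 (xin h) (Y (size h)).

(** The j for which b = a - f(x,y) + j, the event measured by [Eterm]. *)
Definition box_error (h : seq (F * F)) (c : F * F) : F :=
  c.2 - c.1 + f (xin h) (Y (size h)).

Definition error_sum (h : seq (F * F)) : F :=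
  z0 + \sum_(k < size h) sigma k * box_error (take k h) (nth (0, 0) h k).

Lemma error_sum_rcons h c :
  error_sum (rcons h c) = error_sum h + sigma (size h) * box_error h c.
Proof.
rewrite /error_sum size_rcons big_ord_recr /= addrA; congr (_ + _ + _); last first.
  by rewrite nth_rcons ltnn eqxx -cats1 take_size_cat.
apply: eq_bigr => k _; rewrite nth_rcons ltn_ord -cats1 takel_cat //.
exact/ltnW.
Qed.

Lemma outcome_weight_total h : \sum_c outcome_weight h c = 1.
Proof. by case: HP => _ /(_ (xin h) (Y (size h))). Qed.

(* Conditionally on the past, the error of the current box equals j with
   probability [Eterm], hence at least [nu]. *)
Lemma zero_sum_bound_le n h :
  zero_sum_bound (nu P f) sigma n (size h) (error_sum h) <=
  tree_sum outcome_weight n (fun h => (error_sum h == 0)%:R) h.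
Proof.
elim: n h => [|n IH] h //=.
apply: (@le_trans _ _ (\sum_c outcome_weight h c *
   zero_sum_bound (nu P f) sigma n (size h).+1 (error_sum h + sigma (size h) * box_error h c)));
  last first.
  apply: ler_sum => c _; apply: ler_wpM2l; first exact: P0.
  by have := IH (rcons h c); rewrite size_rcons error_sum_rcons.
case: ifPn => [/eqP -> | _].
  under eq_bigr => c _ do rewrite mul0r addr0.
  by rewrite -mulr_suml outcome_weight_total mul1r.
rewrite -(pair_bigA _ (fun a b => outcome_weight h (a, b) *
  zero_sum_bound (nu P f) sigma n (size h).+1
    (error_sum h + sigma (size h) * box_error h (a, b)))) /=.
set fx := f (xin h) (Y (size h)).
have -> : \sum_a \sum_b outcome_weight h (a, b) *
    zero_sum_bound (nu P f) sigma n (size h).+1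
      (error_sum h + sigma (size h) * box_error h (a, b)) =
  \sum_j Eterm P f (xin h) (Y (size h)) j *
    zero_sum_bound (nu P f) sigma n (size h).+1 (error_sum h + sigma (size h) * j).
  under [RHS]eq_bigr => j _ do rewrite /Eterm rsumE mulr_suml.
  rewrite [RHS]exchange_big; apply: eq_bigr => a _ /=.
  (* For fixed a, Bob's output is replaced by the error: b = a - fx + j. *)
  rewrite (reindex_inj (addrI (a - fx))) /=; apply: eq_bigr => j _.
  rewrite /outcome_weight /box_error /= -/fx; congr (_ * _); congr zero_sum_bound.
  by congr (_ + _ * _); ring.
apply: ler_sum => j _; apply: ler_wpM2r; first exact: zero_sum_bound_ge0.
exact: nu_le.
Qed.

End BoxErrors.

(** * Runs that use the boxes in their numerical order *)

Section SequentialRuns.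
Local Open Scope ring_scope.
Variables (p m : nat).
Local Notation F := 'F_p.

Definition in_order (X : nat -> (nat -> F) -> F) (h : seq ('I_m.+1 * F)) : 'I_m.+1 * F :=
  (inord (size h), X (size h) (nth 0 (unzip2 h))).

Variables (X : nat -> (nat -> F) -> F) (a : 'I_m.+1 -> F).

Definition outputs (k : nat) : seq F := [seq a (inord j) | j <- iota 0 k].

Lemma run_in_order fuel k :
  run fuel (in_order X) a [seq (inord j, a (inord j)) | j <- iota 0 k] =
  [seq (inord j, X j (nth 0 (outputs j)), a (inord j)) | j <- iota k fuel].
Proof.
elim: fuel k => //= n IH k; rewrite /in_order size_map size_iota /= -IH.
congr (_ :: _); first by rewrite /unzip2 -map_comp.
by congr run; rewrite -[k.+1]addn1 iotaD map_cat cats1.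
Qed.

Lemma history_of_in_order :
  unzip2 (history_of (run m.+1 (in_order X) a [::])) = outputs m.+1.
Proof. by rewrite (run_in_order m.+1 0) /history_of /unzip2 -!map_comp. Qed.

(** Each box is used exactly once, box k at step k. *)
Lemma input_of_in_order (k : 'I_m.+1) :
  input_of (run m.+1 (in_order X) a [::]) k = X k (nth 0 (outputs k)).
Proof.
rewrite (run_in_order m.+1 0) /input_of filter_map.
have -> : [seq j <- iota 0 m.+1 | (inord j : 'I_m.+1) == k] = [:: (k : nat)].
  rewrite (@eq_in_filter _ _ (pred1 (k : nat))); last first.
    by move=> j; rewrite mem_iota => /andP[_ lt]; rewrite -val_eqE /= inordK.
  by rewrite filter_pred1_uniq ?iota_uniq // mem_iota /= ltn_ord.
by [].
Qed.

End SequentialRuns.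

(** * The nested random access code *)

Section TreeProtocol.
Local Open Scope ring_scope.
Variables (p : nat) (pp : prime p) (f : 'F_p -> 'F_p -> 'F_p).
Local Notation F := 'F_p.
Variables (sq : seq (bool * F * F)) (C : F) (g h : F -> F).
Hypothesis C0 : C != 0.
Hypothesis sqE : forall x y, shift_sum sq f x y = C * x * y + g x + h y.
Variables (M n : nat).
Hypothesis M0 : (0 < M)%N.

(* One layer of boxes: box (v, (t, (s, al, be))) belongs to node v, multiplies
   the difference of the t-th and 0-th inputs of that node by the indicator of t
   being Bob's digit, and is the term (s, al, be) of the iterated difference. *)
Definition layer : seq (nat * (nat * (bool * F * F))) :=
  [seq (v, d) | v <- iota 0 (M ^ n), d <- [seq (t, e) | t <- iota 1 M.-1, e <- sq]].

(** Every layer has M^n nodes, enough for any level, so all layers have the same size and box k sits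
    in layer k / B at position k mod B. *)
Let B := size layer.

Definition descr (j : nat) := nth (0%N, (0%N, (false, 0, 0))) layer j.
Definition node j := (descr j).1.
Definition slot j := (descr j).2.1.
Definition sign j : F := (-1) ^+ (descr j).2.2.1.1.
Definition xshift j : F := (descr j).2.2.1.2.
Definition yshift j : F := (descr j).2.2.2.

(** Division by C cancels the coefficient of the bilinear term, leaving the bare difference of the
    two inputs. *)
Definition slope (w : nat -> F) (v t : nat) : F := (w (v * M + t)%N - w (v * M)%N) / C.

(** The value Alice assigns to node v at height l: that of its 0-th child, corrected by her signed
    outputs at v and by her local terms. The root value becomes the message. *)
Fixpoint wire (x a : nat -> F) (l : nat) (v : nat) : F :=
  if l is l'.+1 then
    let w := wire x a l' in
    w (v * M)%N + \sum_(0 <= j < B) (if node j == v then sign j else 0) * a (l' * B + j)%N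
    - \sum_(t <- iota 1 M.-1) g (slope w v t)
  else x v.

Definition alice_input (x : nat -> F) (k : nat) (a : nat -> F) : F :=
  slope (wire x a (k %/ B)) (node (k %% B)) (slot (k %% B)) + xshift (k %% B).

Definition digit (i l : nat) : nat := (i %/ M ^ l) %% M.

Definition bob_input (i k : nat) : F :=
  (slot (k %% B) == digit i (k %/ B))%:R + yshift (k %% B).

Definition path_sign (i l j : nat) : F :=
  if node j == (i %/ M ^ l.+1)%N then sign j else 0.

(* Box n * B is a dummy, so that the number of boxes is positive even when M = 1. *)
Definition error_sign (i k : nat) : F :=
  if (k < n * B)%N then path_sign i (k %/ B) (k %% B) else 0.

Definition bob_offset (i : nat) (b : nat -> F) : F :=
  \sum_(0 <= l < n) (\sum_(0 <= j < B) path_sign i l j * b (l * B + j)%N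
    + \sum_(t <- iota 1 M.-1) h (t == digit i l)%:R).

(** Height l reads only the layers before l, so Alice can compute the inputs of layer l from outputs
    she already has. *)
Lemma eq_wire x a a' l v : (forall k, (k < l * B)%N -> a k = a' k) ->
  wire x a l v = wire x a' l v.
Proof.
elim: l v => //= l IH v e.
have IH' u : wire x a l u = wire x a' l u.
  by apply: IH => k lt; apply: e; rewrite mulSn ltn_addl.
rewrite IH'; congr (_ + _ - _).
  apply: eq_big_nat => j /andP[_ jB]; rewrite e //.
  by rewrite mulSn addnC ltn_add2r.
by apply: eq_bigr => t _; rewrite /slope !IH'.
Qed.

Lemma big_layer (T : Type) (idx : T) (op : Monoid.com_law idx)
    (G : nat -> nat -> bool * F * F -> T) :
  \big[op/idx]_(0 <= j < B) G (node j) (slot j) (descr j).2.2 =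
  \big[op/idx]_(v <- iota 0 (M ^ n)) \big[op/idx]_(t <- iota 1 M.-1)
    \big[op/idx]_(e <- sq) G v t e.
Proof.
rewrite -(big_nth _ predT (fun d => G d.1 d.2.1 d.2.2)) big_allpairs_dep.
by apply: eq_bigr => v _; rewrite big_allpairs_dep.
Qed.

Lemma big_path (T : Type) (idx : T) (op : Monoid.com_law idx) (G : nat -> bool * F * F -> T) i l :
  (i < M ^ n)%N ->
  \big[op/idx]_(0 <= j < B) (if node j == (i %/ M ^ l.+1)%N
                             then G (slot j) (descr j).2.2 else idx) =
  \big[op/idx]_(t <- iota 1 M.-1) \big[op/idx]_(e <- sq) G t e.
Proof.
move=> iN; have vN : (i %/ M ^ l.+1 < M ^ n)%N by exact: leq_ltn_trans (leq_div _ _) iN.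
rewrite (big_layer op (fun v t e => if v == (i %/ M ^ l.+1)%N then G t e else idx)).
rewrite (bigD1_seq (i %/ M ^ l.+1)%N) ?mem_iota ?iota_uniq //= eqxx.
rewrite [X in op _ X]big1 ?Monoid.mulm1 // => v /negPf ne.
by rewrite big1 // => t _; rewrite big1 // => e _; rewrite ne.
Qed.

Lemma divn_layer l j : (j < B)%N -> ((l * B + j) %/ B = l)%N.
Proof. by move=> jB; rewrite divnMDl ?divn_small ?addn0 //; lia. Qed.

Lemma modn_layer l j : (j < B)%N -> ((l * B + j) %% B = j)%N.
Proof. by move=> jB; rewrite modnMDl modn_small. Qed.

Section Decoding.
Variables (x a b : nat -> F) (past : nat -> nat -> F) (i : nat).
Hypothesis pastE : forall k j, (j < k)%N -> past k j = a j.
Hypothesis iN : (i < M ^ n)%N.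

Let err k : F := b k - a k + f (alice_input x k (past k)) (bob_input i k).

(** On the path a = b + f - err. The signed sum of the f-terms, by [sqE], moves the value from the
    0-th child to the child on the path; g cancels against Alice's correction and h is left to
    Bob. *)
Lemma wire_step l :
  wire x a l.+1 (i %/ M ^ l.+1)%N =
  wire x a l (i %/ M ^ l)%N
  + (\sum_(0 <= j < B) path_sign i l j * b (l * B + j)%N
     + \sum_(t <- iota 1 M.-1) h (t == digit i l)%:R)
  - \sum_(0 <= j < B) path_sign i l j * err (l * B + j)%N.
Proof.
set G := (i %/ M ^ l.+1)%N; set D := (i %/ M ^ l)%N; set w := wire x a l.
have GD : (G = D %/ M)%N by rewrite /G expnSr divnMA.
have sumf : \sum_(0 <= j < B) path_sign i l j *
    f (alice_input x (l * B + j) (past (l * B + j)%N)) (bob_input i (l * B + j)) =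
    \sum_(t <- iota 1 M.-1) (C * slope w G t * (t == digit i l)%:R
       + g (slope w G t) + h (t == digit i l)%:R).
  under [RHS]eq_bigr => t _ do rewrite -sqE.
  rewrite -(big_path _ (fun t (e : bool * F * F) => (-1) ^+ e.1.1 *
     f (slope w G t + e.1.2) ((t == digit i l)%:R + e.2)) l iN).
  apply: eq_big_nat => j /andP[_ jB]; rewrite /path_sign -/G.
  case: eqP => [nG|_]; last by rewrite mul0r.
  rewrite /alice_input /bob_input divn_layer // modn_layer // nG.
  congr (_ * f (_ + _) _); rewrite /slope.
  by congr ((_ - _) / _); apply: eq_wire => k lt; apply: pastE; lia.
have pick : \sum_(t <- iota 1 M.-1) C * slope w G t * (t == digit i l)%:R = w D - w (G * M)%N.
  have dM : (digit i l < M)%N by rewrite /digit ltn_mod.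
  have DE : D = (G * M + digit i l)%N by rewrite GD /digit -divn_eq.
  under eq_bigr => t _ do rewrite /slope mulrCA divff // mulr1.
  (* Digit 0 matches no slot t >= 1, and the 0-th child is then the wanted one; any other digit
     matches exactly one slot. *)
  have [d0|d0] := posnP (digit i l).
    rewrite DE d0 addn0 subrr big_seq big1 // => t; rewrite mem_iota => /andP[t1 _].
    by case: eqP => [e|]; rewrite ?mulr0 //; lia.
  rewrite (bigD1_seq (digit i l)) ?iota_uniq //=; last by rewrite mem_iota; lia.
  rewrite eqxx mulr1 -DE big1 ?addr0 // => t /negPf ->.
  by rewrite mulr0.
have step : \sum_(0 <= j < B) path_sign i l j * err (l * B + j)%N =
   \sum_(0 <= j < B) path_sign i l j * b (l * B + j)%N
   - \sum_(0 <= j < B) path_sign i l j * a (l * B + j)%N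
   + \sum_(0 <= j < B) path_sign i l j *
    f (alice_input x (l * B + j) (past (l * B + j)%N)) (bob_input i (l * B + j)).
  by rewrite -sumrB -big_split; apply: eq_bigr => j _ /=; rewrite /err; ring.
rewrite step sumf !big_split /= pick -/w; ring.
Qed.

Lemma big_boxes (T : Type) (idx : T) (op : Monoid.com_law idx) (G : F -> nat -> T) :
  (forall k, G 0 k = idx) ->
  \big[op/idx]_(0 <= k < (n * B).+1) G (error_sign i k) k =
  \big[op/idx]_(0 <= l < n) \big[op/idx]_(0 <= j < B) G (path_sign i l j) (l * B + j)%N.
Proof.
move=> G0; rewrite big_nat_recr //= {2}/error_sign ltnn G0 Monoid.mulm1 big_nat_mul.
apply: eq_big_nat => l /andP[_ ln].
rewrite -{1}[(l * B)%N]add0n mulSn big_addn addnK.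
apply: eq_big_nat => j /andP[_ jB].
rewrite addnC /error_sign divn_layer // modn_layer //.
by rewrite (_ : (_ < _)%N) //; nia.
Qed.

(** Telescoping [wire_step] from leaf i to the root leaves x_i, Bob's offset and the signed errors
    on the path. *)
Lemma decode :
  wire x a n 0 - bob_offset i b =
  x i - \sum_(0 <= k < (n * B).+1) error_sign i k * err k.
Proof.
rewrite (@big_boxes _ _ +%R (fun s k => s * err k)) => [|k]; last exact: mul0r.
have H l : (l <= n)%N -> wire x a l (i %/ M ^ l)%N = x i +
   \sum_(0 <= l < l) (\sum_(0 <= j < B) path_sign i l j * b (l * B + j)%N
    + \sum_(t <- iota 1 M.-1) h (t == digit i l)%:R)
   - \sum_(0 <= l < l) \sum_(0 <= j < B) path_sign i l j * err (l * B + j)%N.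
  elim: l => [_|l IH ln]; first by rewrite !big_geq // divn1 addr0 subr0.
  by rewrite wire_step IH ?(ltnW ln) // !big_nat_recr //=; ring.
by have := H n (leqnn n); rewrite divn_small // => ->; rewrite /bob_offset; ring.
Qed.

(** The path meets one node in each of n layers, with M - 1 slots and e shifts of either sign; all
    other boxes contribute the factor 1. *)
Lemma prod_fourier_factor (nuv : F -> R) e k :
  count (fun d => ~~ d.1.1) sq = e -> count (fun d => d.1.1) sq = e ->
  \prod_(0 <= l < (n * B).+1) fourier_factor nuv (error_sign i l) k =
  fourier nuv 1 k ^+ (n * M.-1 * e) * fourier nuv (-1) k ^+ (n * M.-1 * e).
Proof.
move=> c0 c1.
have prod_sq : \prod_(d <- sq) fourier_factor nuv ((-1) ^+ d.1.1) k =
    fourier nuv 1 k ^+ e * fourier nuv (-1) k ^+ e.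
  rewrite -{1}c0 -c1; elim: sq => [|d s IH]; first by rewrite big_nil mulr1.
  rewrite big_cons IH /= /fourier_factor.
  case: d.1.1 => /=; rewrite add0n add1n.
    by rewrite expr1 oppr_eq0 oner_eq0 exprS mulrCA.
  by rewrite expr0 ?oner_eq0 exprS mulrA.
rewrite (@big_boxes _ _ *%R (fun s _ => fourier_factor nuv s k)) => [|_]; last first.
  by rewrite /fourier_factor eqxx.
under eq_bigr => l _.
  rewrite (eq_bigr (fun j => if node j == (i %/ M ^ l.+1)%N
      then fourier_factor nuv ((-1) ^+ (descr j).2.2.1.1) k else 1)); last first.
    by move=> j _; rewrite /path_sign; case: ifP => // _; rewrite /fourier_factor eqxx.
  rewrite (big_path _ (fun _ (d : bool * F * F) => fourier_factor nuv ((-1) ^+ d.1.1) k)) //.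
  under eq_bigr => t _ do rewrite prod_sq.
  rewrite big_const_seq count_predT size_iota -exprMn iter_mulr_1 -exprM.
over.
by rewrite big_const_nat subn0 iter_mulr_1 -exprM -exprMn; congr (_ ^+ _); lia.
Qed.

End Decoding.
End TreeProtocol.

(** * Joint distribution of input and guess *)

Section InOrderProtocols.
Local Open Scope ring_scope.
Variables (p : nat) (pp : prime p) (P : box p).
Hypothesis HP : is_box P.
Local Notation F := 'F_p.

Lemma outputs_tuple (T : Type) (pr : T -> F) m (t : m.+1.-tuple T) k : (k <= m.+1)%N ->
  outputs (fun j => pr (tnth t j)) k = [seq pr c | c <- take k t].
Proof.
move=> km; have st : size (take k t) = k by rewrite size_take size_tuple; case: ltngtP km.
apply: (@eq_from_nth _ 0) => [|j]; rewrite !size_map size_iota ?st // => jk.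
have x0 := tnth t ord0.
rewrite (nth_map 0%N) ?size_iota // nth_iota // add0n (nth_map x0) ?st // nth_take //.
by rewrite (tnth_nth x0) inordK // (leq_trans jk).
Qed.

(** A pair of output vectors is reindexed as one tuple of output pairs, so the product over boxes
    becomes a chain of conditional weights. *)
Lemma sum_outputs_tree m (X : nat -> (nat -> F) -> F) (Y : nat -> F)
    (Phi : (nat -> F) -> (nat -> F) -> bool) (K : R) :
  \sum_(a : {ffun 'I_m.+1 -> F}) \sum_(b : {ffun 'I_m.+1 -> F})
    (if Phi (nth 0 (outputs a m.+1)) (nth 0 (outputs b m.+1)) then
       K * \prod_(k < m.+1) P (a k) (b k) (X k (nth 0 (outputs a k))) (Y k)
     else 0) =
  K * tree_sum (outcome_weight P X Y) m.+1
    (fun h => (Phi (nth 0 (unzip1 h)) (nth 0 (unzip2 h)))%:R) [::].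
Proof.
rewrite (tree_sumE _ _ _ _ (0, 0)) mulr_sumr pair_bigA /=.
rewrite (reindex (fun t : m.+1.-tuple (F * F) =>
  ([ffun k => (tnth t k).1], [ffun k => (tnth t k).2]) :
    {ffun 'I_m.+1 -> F} * {ffun 'I_m.+1 -> F})) /=; last first.
  exists (fun ab : {ffun 'I_m.+1 -> F} * {ffun 'I_m.+1 -> F} =>
    [tuple (ab.1 k, ab.2 k) | k < m.+1]) => [t _|[a b] _] /=.
    by apply: eq_from_tnth => k; rewrite tnth_mktuple !ffunE; case: (tnth t k).
  by congr (_, _); apply/ffunP => k; rewrite ffunE tnth_mktuple.
apply: eq_bigr => t _.
have o1 k : (k <= m.+1)%N ->
    outputs [ffun k => (tnth t k).1] k = unzip1 (take k t).
  move=> km; rewrite /unzip1 -(outputs_tuple fst) //.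
  by apply: eq_map => j; rewrite ffunE.
have o2 k : (k <= m.+1)%N ->
    outputs [ffun k => (tnth t k).2] k = unzip2 (take k t).
  move=> km; rewrite /unzip2 -(outputs_tuple snd) //.
  by apply: eq_map => j; rewrite ffunE.
have tk : take m.+1 t = t by rewrite take_oversize ?size_tuple.
rewrite o1 // o2 // tk; case: (Phi _ _); last by rewrite !mulr0.
rewrite mulr1; congr (_ * _); apply: eq_bigr => k _.
have km : (k <= m.+1)%N by exact/ltnW.
rewrite o1 // !ffunE /outcome_weight /xin size_take size_tuple ltn_ord.
by rewrite !(tnth_nth (0, 0)).
Qed.

Lemma tree_sum_sum (T I : finType) (w : seq T -> T -> R) n (Phi : I -> seq T -> R) h :
  \sum_i tree_sum w n (Phi i) h = tree_sum w n (fun h => \sum_i Phi i h) h.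
Proof.
elim: n h => //= n IH h; rewrite exchange_big; apply: eq_bigr => c _.
by rewrite -mulr_sumr IH.
Qed.

Variables (N m : nat).
Variables (X : {ffun 'I_N -> F} -> nat -> (nat -> F) -> F) (Y : 'I_N -> nat -> F).
Variables (V : {ffun 'I_N -> F} -> (nat -> F) -> F) (W : 'I_N -> (nat -> F) -> F).

Definition joint : 'I_N -> F -> F -> R :=
  ic_joint P (fun _ : unit => 1)
    (fun xv _ => @in_order p m (X xv))
    (fun xv _ hs => V xv (nth 0 (unzip2 hs)))
    (fun i _ _ => @in_order p m (fun k _ => Y i k))
    (fun i q _ hs => q - W i (nth 0 (unzip2 hs))).

Definition guess_prob i xv v : R :=
  tree_sum (outcome_weight P (X xv) (Y i)) m.+1
    (fun h => (V xv (nth 0 (unzip1 h)) - W i (nth 0 (unzip2 h)) == v)%:R) [::].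

Lemma jointE i u v :
  joint i u v = \sum_(xv : {ffun 'I_N -> F} | xv i == u) (p ^ N)%:R^-1 * guess_prob i xv v.
Proof.
rewrite big_mkcond; apply: eq_bigr => xv _; case: ifP => // _.
rewrite -(@sum_outputs_tree m (X xv) (Y i) (fun a b => V xv a - W i b == v)).
rewrite (@rsumE unit) (big_pred1 tt); last by case.
apply: eq_bigr => a _; apply: eq_bigr => b _; cbv beta zeta.
rewrite !history_of_in_order; case: ifP => // _.
rewrite INRE RinvE !RmultE mulr1; congr (_ * _).
by apply: eq_bigr => k _; rewrite !input_of_in_order.
Qed.

Lemma guess_prob_ge0 i xv v : 0 <= guess_prob i xv v.
Proof.
rewrite /guess_prob (tree_sumE _ _ _ _ (0, 0)); apply: sumr_ge0 => t _.
apply: mulr_ge0; last exact: ler0n.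
by apply: prodr_ge0 => k _; apply/RleP; exact: (proj1 HP).
Qed.

Lemma joint_ge0 i u v : 0 <= joint i u v.
Proof.
rewrite jointE; apply: sumr_ge0 => xv _; apply: mulr_ge0; last exact: guess_prob_ge0.
by rewrite invr_ge0.
Qed.

(** Translation by a constant vector maps one fibre onto another, so all p fibres have equal
    size. *)
Lemma card_fiber (i : 'I_N) (u : F) : (#|[pred xv : {ffun 'I_N -> F} | xv i == u]| * p = p ^ N)%N.
Proof.
have eqc w : #|[pred xv : {ffun 'I_N -> F} | xv i == w]| =
    #|[pred xv : {ffun 'I_N -> F} | xv i == u]|.
  rewrite -!sum1_card.
  rewrite (reindex_inj (addIr ([ffun => w - u] : {ffun 'I_N -> F}))) /=.
  by apply: eq_bigl => xv; rewrite !inE !ffunE addrA subr_eq addrC (inj_eq (addrI _)).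
have := sum1_card {: {ffun 'I_N -> F}}.
rewrite card_ffun card_Fp // card_ord (partition_big (fun xv : {ffun _} => xv i) predT) //=.
move=> <-; rewrite (eq_bigr (fun _ => #|[pred xv : {ffun 'I_N -> F} | xv i == u]|)).
  by rewrite sum_nat_const card_Fp // mulnC.
by move=> w _; rewrite sum1_card eqc.
Qed.

Lemma joint_marginal i u : \sum_v joint i u v = p%:R^-1.
Proof.
under eq_bigr => v _ do rewrite jointE.
rewrite exchange_big /=.
rewrite (eq_bigr (fun _ => (p ^ N)%:R^-1)) => [|xv _]; last first.
  rewrite -mulr_sumr /guess_prob tree_sum_sum.
  rewrite (@eq_tree_sum _ _ _ _ (fun _ => 1)).
    by rewrite tree_sum_total ?mulr1 // => h; apply: outcome_weight_total.
  (* Exactly one v is guessed for each outcome history. *)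
  move=> h _; rewrite (bigD1 (V xv (nth 0 (unzip1 h)) - W i (nth 0 (unzip2 h)))) //=.
  by rewrite eqxx big1 ?addr0 // => v; rewrite eq_sym => /negPf ->.
have p0 : (p%:R : R) != 0 by rewrite pnatr_eq0 -lt0n prime_gt0.
have q0 : ((p ^ N)%:R : R) != 0 by rewrite natrX expf_neq0.
rewrite sumr_const -[LHS]mulr_natr.
apply: (mulfI q0); rewrite mulrA divff // mul1r -(card_fiber i u) natrM mulfK //.
Qed.

Lemma joint_diag i S : (forall xv : {ffun 'I_N -> F}, S <= guess_prob i xv (xv i)) ->
  S <= \sum_u joint i u u.
Proof.
move=> hS; have q0 : ((p ^ N)%:R : R) != 0 by rewrite natrX expf_neq0 // pnatr_eq0 -lt0n prime_gt0.
have -> : \sum_u joint i u u = \sum_(xv : {ffun 'I_N -> F}) (p ^ N)%:R^-1 * guess_prob i xv (xv i).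
  rewrite (partition_big (fun xv : {ffun _} => xv i) predT) //=.
  by apply: eq_bigr => u _; rewrite jointE; apply: eq_bigr => xv /eqP ->.
have -> : S = \sum_(xv : {ffun 'I_N -> F}) (p ^ N)%:R^-1 * S.
  rewrite sumr_const card_ffun card_Fp // card_ord -[RHS]mulr_natl mulrA divff //.
  by rewrite mul1r.
by apply: ler_sum => xv _; apply: ler_wpM2l; rewrite ?invr_ge0.
Qed.

Lemma success_bound S : info_causality P -> (0 < N)%N ->
  (forall i (xv : {ffun 'I_N -> F}), S <= guess_prob i xv (xv i)) ->
  Rle S (Tp_inv p (Rmult (Rdiv (Rminus (INR N) 1) (INR N)) (log2 (INR p)))).
Proof.
move=> Hic N0 hS; apply: (success_le_Tp_inv (J := joint)) => //.
- by move=> i u v; apply/RleP/joint_ge0.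
- by move=> i u; rewrite INRE; exact: joint_marginal.
- by move=> i; apply/RleP/joint_diag.
apply: Hic => //; first by move=> _; apply/RleP; exact: ler01.
by rewrite rsumE (big_pred1 tt) //; case.
Qed.

End InOrderProtocols.

(** * The success probability of the nested code *)

Section NestedBound.
Local Open Scope ring_scope.
Variables (p : nat) (pp : prime p) (f : 'F_p -> 'F_p -> 'F_p) (P : box p).
Hypotheses (HP : is_box P) (Hic : info_causality P).
Local Notation F := 'F_p.

Lemma nested_bound M n e (c : F) : (0 < M)%N -> (0 < e)%N -> good_shifts e f ->
  let L := (n * (M - 1) * 2 ^ e)%N in
  (ic_lhs (nu P f) c L).2 = 0 /\
  Rle (ic_lhs (nu P f) c L).1
    (Tp_inv p (Rmult (Rdiv (Rminus (INR (M ^ n)) 1) (INR (M ^ n))) (log2 (INR p)))).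
Proof.
move=> M0 e0 [sq [c0 c1 [C [g [h [C0 sqE]]]]]] L.
(* As e > 0, each sign occurs exactly 2^(e-1) times, giving the exponent L/2 for both transforms. *)
have e2 : (2 ^ e = (2 ^ e.-1).*2)%N by rewrite -{1}(prednK e0) expnS mul2n.
rewrite e2 uphalf_double in c0; rewrite e2 doubleK in c1.
have L2 : (L./2 = n * M.-1 * 2 ^ e.-1)%N by rewrite /L e2 -doubleMr doubleK subn1.
have N0 : (0 < M ^ n)%N by rewrite expn_gt0 M0.
pose B := size (layer sq M n).
pose ext (xv : {ffun 'I_(M ^ n) -> F}) (k : nat) : F := oapp xv 0 (insub k).
have lhsE (i : 'I_(M ^ n)) : ic_lhs (nu P f) c L =
    (zero_sum_bound (nu P f) (error_sign sq M n i) (n * B).+1 0 c, 0).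
  apply: (ic_lhs_zero_sum_bound pp) => x.
  by rewrite L2; apply: (prod_fourier_factor pp C0).
have := lhsE (Ordinal N0) => E0; rewrite {1}E0; split=> //.
apply: (@success_bound _ pp P HP (M ^ n) (n * B)
  (fun xv => alice_input sq C g M n (ext xv)) (fun i => bob_input sq M n i)
  (fun xv a => wire sq C g M n (ext xv) a n 0)
  (* Bob also subtracts c, so he is right exactly when c plus the signed error sum is 0; hence the
     error sum below starts at c. *)
  (fun i b => bob_offset sq h M n i b + c)) => // i xv.
rewrite (lhsE i) /=.
have := @zero_sum_bound_le p P f HP (alice_input sq C g M n (ext xv)) (bob_input sq M n i)
  (error_sign sq M n i) c (n * B).+1 [::].
rewrite {1}/error_sum big_ord0 addr0 => /le_trans; apply.
rewrite le_eqVlt; apply/orP; left; apply/eqP; apply: eq_tree_sum => t st /=.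
congr (_%:R); congr nat_of_bool.
have := @decode p pp f sq C g h C0 sqE M n M0 (ext xv) (nth 0 (unzip1 t)) (nth 0 (unzip2 t))
  (fun k => nth 0 (unzip1 (take k t))) i.
rewrite /ext valK /= => /(_ _ (ltn_ord i)) D.
rewrite opprD addrA D; last first.
  move=> k j jk; case: (ltnP j (size t)) => js.
    by rewrite /unzip1 map_take nth_take.
  by rewrite !nth_default ?size_map // size_take_min geq_min js orbT.
rewrite -addrA -opprD subr_eq -{1}[xv i]addr0 (inj_eq (addrI _)) [RHS]eq_sym.
congr (_ == _); rewrite /error_sum addrC st big_mkord; congr (_ + _).
apply: eq_bigr => k _; rewrite /box_error /xin size_take st ltn_ord.
rewrite (nth_map (0, 0)) ?st // (nth_map (0, 0)) ?st //.
Qed.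

End NestedBound.

From Stdlib Require Import Reals.

Theorem theorem5 (p : nat) (pp : prime p)
  (f : 'F_p -> 'F_p -> 'F_p) (lam : 'I_p -> 'I_p -> 'F_p)
  (Hrep : represents lam f)
  (Hinsep : ~ additively_separable f)
  (HD : (2 < DeltaOf lam)%N)
  (P : box p) (HP : is_box P) (Hns : no_signalling P) (Hic : info_causality P) :
  (forall N : nat, (1 <= N)%N -> (N <= p)%N -> forall c : 'F_p,
     let L := muln (subn N 1) (expn 2 (subn (DeltaOf lam) 2)) in
     (ic_lhs (nu P f) c L).2 = 0%R /\
     ((ic_lhs (nu P f) c L).1 <= Tp_inv p ((INR N - 1) / INR N * log2 (INR p)))%R)
  /\
  (forall n : nat, (1 <= n)%N -> forall c : 'F_p,
     let N := expn p n in
     let L := muln (muln n (subn p 1)) (expn 2 (subn (DeltaOf lam) 2)) in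
     (ic_lhs (nu P f) c L).2 = 0%R /\
     ((ic_lhs (nu P f) c L).1 <= Tp_inv p ((INR N - 1) / INR N * log2 (INR p)))%R).
Proof.
have shifts := good_shifts_Delta pp Hrep HD.
have e0 : leq 1 (subn (DeltaOf lam) 2) by rewrite subn_gt0.
split=> [N N1 _ c L | n n1 c N L].
  have := nested_bound pp HP Hic 1 c N1 e0 shifts.
  by rewrite mul1n expn1.
by have := nested_bound pp HP Hic n c (prime_gt0 pp) e0 shifts.
Qed.
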